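(* Let $d,n\in\mathbb{N}$, $\alpha>1/2$, let $\boldsymbol{\gamma}=(\gamma_1,\gamma_2,\ldots)$ satisfy $1\ge\gamma_1\ge\gamma_2\ge\cdots>0$, let $M\ge1$ be real, and let $\boldsymbol{z}\in\{0,1,\ldots,n-1\}^d$. The squared worst-case $L_2$ approximation error in $C_{d,\alpha,\boldsymbol{\gamma}}$ of the algorithm $A_{n,d,M}$ (truncation of the cosine expansion to the hyperbolic cross $H_M$, with the cosine coefficients approximated by the tent-transformed rank-$1$ lattice rule with generating vector $\boldsymbol{z}$) is bounded by $$e^{\mathrm{wor}}(A_{n,d,M};C_{d,\alpha,\boldsymbol{\gamma}})^2\le\frac1M+\sum_{\boldsymbol{k}\in H_M}\ \sum_{\boldsymbol{0}\ne\boldsymbol{h}\in\Lambda(\boldsymbol{z},n)^\perp}\ \sum_{\boldsymbol{\sigma}\in\{\pm1\}^d}\frac{2^{|\boldsymbol{k}|_0}}{2^d\,r_{\alpha,\boldsymbol{\gamma}}(\boldsymbol{\sigma}(\boldsymbol{h})+\boldsymbol{k})}.$$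
   Context: Notation. $\mathbb{Z}_+=\{0,1,2,\ldots\}$. For $\boldsymbol{k}\in\mathbb{Z}^d$, $|\boldsymbol{k}|_0$ is the number of non-zero components. For $\boldsymbol{\sigma}\in\{\pm1\}^d$, $\boldsymbol{\sigma}(\boldsymbol{k})=(\sigma_1k_1,\ldots,\sigma_dk_d)$. The half-period cosine basis of $L_2([0,1]^d)$ is $\phi_{\boldsymbol{k}}(\boldsymbol{x})=(\sqrt2)^{|\boldsymbol{k}|_0}\prod_{j=1}^d\cos(\pi k_jx_j)$, $\boldsymbol{k}\in\mathbb{Z}_+^d$, and $\hat f(\boldsymbol{k})=\int_{[0,1]^d}f(\boldsymbol{x})\phi_{\boldsymbol{k}}(\boldsymbol{x})\,d\boldsymbol{x}$. For $\boldsymbol{k}\in\mathbb{Z}^d$, $r_{\alpha,\boldsymbol{\gamma}}(\boldsymbol{k})=\prod_{j=1}^d r_{\alpha,\gamma_j}(k_j)$, where $r_{\alpha,\gamma_j}(0)=1$ and $r_{\alpha,\gamma_j}(k)=|k|^{2\alpha}/\gamma_j$ for $k\ne0$. Cosine space: $C_{d,\alpha,\boldsymbol{\gamma}}$ is the space of complex-valued $f\in L_2([0,1]^d)$ with $\|f\|_{C_{d,\alpha,\boldsymbol{\gamma}}}^2=\sum_{\boldsymbol{k}\in\mathbb{Z}_+^d}|\hat f(\boldsymbol{k})|^2r_{\alpha,\boldsymbol{\gamma}}(\boldsymbol{k})<\infty$; for $\alpha>1/2$ it is a reproducing kernel Hilbert space, each $f$ being identified with its continuous representative $\sum_{\boldsymbol{k}\in\mathbb{Z}_+^d}\hat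 f(\boldsymbol{k})\phi_{\boldsymbol{k}}$. Weighted hyperbolic cross: $H_M=\{\boldsymbol{k}\in\mathbb{Z}_+^d:r_{\alpha,\boldsymbol{\gamma}}(\boldsymbol{k})\le M\}$. Tent transformation: $\psi(x)=1-|2x-1|$ on $[0,1]$, applied componentwise. With $\boldsymbol{t}_i=\psi(\tfrac{i\boldsymbol{z}}n\bmod1)$, $i=1,\ldots,n$, the algorithm is $$A_{n,d,M}(f)(\boldsymbol{x})=\sum_{\boldsymbol{k}\in H_M}\Big(\frac1n\sum_{i=1}^nf(\boldsymbol{t}_i)\phi_{\boldsymbol{k}}(\boldsymbol{t}_i)\Big)\phi_{\boldsymbol{k}}(\boldsymbol{x}).$$ Its worst-case error is $e^{\mathrm{wor}}(A_{n,d,M};C_{d,\alpha,\boldsymbol{\gamma}})=\sup_{f\in C_{d,\alpha,\boldsymbol{\gamma}},\ \|f\|_{C_{d,\alpha,\boldsymbol{\gamma}}}\le1}\|f-A_{n,d,M}(f)\|_{L_2([0,1]^d)}$. Dual lattice: $\Lambda(\boldsymbol{z},n)^\perp=\{\boldsymbol{h}\in\mathbb{Z}^d:\boldsymbol{h}\cdot\boldsymbol{z}\equiv0\pmod n\}$. *)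

(* Defs.v *)
From HB Require Import structures.
From mathcomp Require Import all_boot all_order all_algebra finmap.
From mathcomp Require Import complex.
From mathcomp Require Import all_classical all_reals all_analysis.

Set Implicit Arguments.
Unset Strict Implicit.
Unset Printing Implicit Defensive.
Import Order.TTheory GRing.Theory Num.Theory.
Import numFieldNormedType.Exports.
Local Open Scope classical_set_scope.
Local Open Scope ring_scope.
Local Open Scope complex_scope.


(* R^d; the tuple instance carries the product (Borel) sigma-algebra *)
Notation space R d := (d.-tuple (measurableTypeR R)).

Section lebesgue_tuple.
Context {R : realType}.

Definition tcons d (p : measurableTypeR R * space R d) : space R d.+1 :=
  [tuple of p.1 :: p.2].

Lemma measurable_tcons d : measurable_fun setT (@tcons d).
Proof. exact: (measurable_cons measurable_fst measurable_snd). Qed.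

Section step.
Variables (d : nat) (m : {sigma_finite_measure set (space R d) -> \bar R}).

Definition tcons_measure : set (space R d.+1) -> \bar R :=
  pushforward (lebesgue_measure \x m)%E (@tcons d).

Let mP : {measure set (space R d.+1) -> \bar R} :=
  measure_function_pushforward__canonical__measure_function_Measure
    (lebesgue_measure \x m)%E (@measurable_tcons d).

HB.instance Definition _ := isMeasure.Build _ _ _ tcons_measure
  (measure0 mP) (measure_ge0 mP) (@measure_semi_sigma_additive _ _ _ mP).

Let tcons_measure_sigma_finite : sigma_finite setT tcons_measure.
Proof.
have /sigma_finiteP[F1 [TF1 ndF1 F1oo]] :=
  sigma_finiteT (@lebesgue_measure R).
have /sigma_finiteP[F2 [TF2 ndF2 F2oo]] := sigma_finiteT m.
pose F n := F1 n `*` F2 n.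
have TF : \bigcup_n F n = setT.
  apply/seteqP; split => // -[x y] _.
  have [i _ Fx] : (\bigcup_n F1 n) x by rewrite -TF1.
  have [j _ Fy] : (\bigcup_n F2 n) y by rewrite -TF2.
  exists (maxn i j) => //; split => /=.
    by move: x Fx; exact/subsetPset/ndF1/leq_maxl.
  by move: y Fy; exact/subsetPset/ndF2/leq_maxr.
have Foo n : measurable (F n) /\ ((lebesgue_measure \x m)%E (F n) < +oo)%E.
  have [? ?] := F1oo n; have [? ?] := F2oo n.
  split; first exact: measurableX.
  by rewrite product_measure1E// lte_mul_pinfty// ge0_fin_numE.
pose g (t : space R d.+1) : measurableTypeR R * space R d :=
  (thead t, [tuple of behead t]).
have mg : measurable_fun setT g.
  apply/measurable_fun_pairP; split.
    exact: (@measurable_tnth _ (measurableTypeR R) d.+1 ord0).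
  exact: measurable_behead.
have gK p : g (tcons p) = p.
  by case: p => x t; rewrite /g /=; congr pair; apply: val_inj.
exists (fun n => g @^-1` F n).
  by rewrite -preimage_bigcup TF preimage_setT.
move=> n; have [mF Fn] := Foo n; split.
  by rewrite -[X in measurable X]setTI; exact: mg.
rewrite /tcons_measure /pushforward -comp_preimage.
by rewrite (_ : g \o @tcons d = id) ?preimage_id//; apply/funext => p /=.
Qed.

HB.instance Definition _ := Measure_isSigmaFinite.Build _ _ _ tcons_measure
  tcons_measure_sigma_finite.
End step.

(* Lebesgue measure on R^d: the d-fold product of Lebesgue measure on R; R^0
   is a point of mass 1. *)
Fixpoint lebesgue d : {sigma_finite_measure set (space R d) -> \bar R} :=
  match d with
  | 0 => dirac ([tuple] : space R 0)
  | d'.+1 => tcons_measure (lebesgue d')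
  end.

Definition box d (a b : 'I_d -> R) : set (space R d) :=
  [set x | forall j, a j <= tnth x j <= b j].

Lemma measurable_box d (a b : 'I_d -> R) : measurable (box a b).
Proof.
rewrite (_ : box a b = \big[setI/setT]_(j < d) ((@tnth _ _ ^~ j) @^-1`
    (`[a j, b j]%classic : set (measurableTypeR R)))).
  apply: bigsetI_measurable => j _; rewrite -[X in measurable X]setTI.
  by apply: measurable_tnth => //; exact: measurable_itv.
rewrite -bigcap_seq.
apply/seteqP; split => x /= h j; first by move=> _; rewrite /= in_itv; exact: h.
by have := h j; rewrite /= in_itv /= => /(_ (mem_index_enum j)).
Qed.

Lemma lebesgue_box d (a b : 'I_d -> R) : (forall j, a j <= b j) ->
  lebesgue d (box a b) = (\prod_(j < d) (b j - a j))%:E.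
Proof.
elim: d a b => [|d IHd] a b ab.
  by rewrite big_ord0 /= diracE mem_set// => j; case: j.
pose A : set (measurableTypeR R) := `[a ord0, b ord0]%classic.
pose B := box (a \o lift ord0) (b \o lift ord0).
rewrite /= /tcons_measure /pushforward.
rewrite (_ : _ @^-1` _ = A `*` B); last first.
  apply/seteqP; split => -[x t] /=.
    move=> h; split.
      by have := h ord0; rewrite /A /= in_itv /= (tnth_nth 0).
    by move=> j /=; have := h (lift ord0 j); rewrite !(tnth_nth 0).
  rewrite /A /= in_itv /= => -[h1 h2] j.
  case: (unliftP ord0 j) => [j'|] ->; last by rewrite (tnth_nth 0).
  by have := h2 j'; rewrite /= !(tnth_nth 0).
have mA : (@lebesgue_measure R) A = (b ord0 - a ord0)%:E.
  rewrite /A lebesgue_measure_itv /= lte_fin.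
  have := ab ord0; rewrite le_eqVlt => /predU1P[->|->//].
  by rewrite ltxx subrr.
rewrite product_measure1E; [|exact: measurable_itv|exact: measurable_box].
rewrite IHd; last by move=> j; exact: ab.
rewrite big_ord_recl EFinM; congr (_ * _)%E; exact: mA.
Qed.
End lebesgue_tuple.

Section cosine_space.
Context {R : realType} (d : nat).
Implicit Types (x : space R d) (f : space R d -> R[i]).

Definition cube : set (space R d) := box (fun=> 0) (fun=> 1).

Definition cintegral f : R[i] :=
  (\int[lebesgue d]_(x in cube) complex.Re (f x))%R +i*
  (\int[lebesgue d]_(x in cube) complex.Im (f x))%R.

Definition L2norm f : \bar R :=
  ((\int[lebesgue d]_(x in cube) (Normc.normc (f x) ^+ 2)%:E) `^ 2^-1)%E.

Definition in_L2 f : Prop :=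
  [/\ measurable_fun cube (fun x => complex.Re (f x) : measurableTypeR R),
      measurable_fun cube (fun x => complex.Im (f x) : measurableTypeR R) &
      (L2norm f < +oo)%E].

Definition toZ (k : {ffun 'I_d -> nat}) : {ffun 'I_d -> int} :=
  [ffun j => (k j)%:Z].

Definition nnz (k : {ffun 'I_d -> int}) : nat := #|[set j | k j != 0]%SET|.

Definition phi (k : {ffun 'I_d -> nat}) x : R :=
  Num.sqrt 2 ^+ nnz (toZ k) * \prod_(j < d) cos (pi * (k j)%:R * tnth x j).

Definition cos_coef f (k : {ffun 'I_d -> nat}) : R[i] :=
  cintegral (fun x => f x * (phi k x)%:C).

(* unconditional convergence, i.e. along the net of finite subsets of I *)
Definition has_sum (I : choiceType) (a : I -> R[i]) (s : R[i]) : Prop :=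
  forall e : R, 0 < e -> exists F0 : {fset I}, forall F : {fset I},
    (F0 `<=` F)%fset -> Normc.normc (\sum_(i <- F) a i - s) < e.

Variables (alpha : R) (gamma : nat -> R).

(* gamma j (j = 0, 1, ...) is the weight of the (j+1)-st coordinate *)
Definition r1 (j : nat) (k : int) : R :=
  if k == 0 then 1 else (`|k|%:~R `^ (2 * alpha)) / gamma j.

Definition r (k : {ffun 'I_d -> int}) : R := \prod_(j < d) r1 j (k j).

Definition cos_norm f : \bar R :=
  ((\esum_(k in [set: {ffun 'I_d -> nat}])
      (Normc.normc (cos_coef f k) ^+ 2 * r (toZ k))%:E) `^ 2^-1)%E.

(* An element of the space is the representative of its L2-class that is given
   on the cube by the pointwise values of its cosine series, so that point
   evaluation makes sense; values outside of the cube are irrelevant. *)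
Definition cosine_space f : Prop :=
  [/\ in_L2 f, (cos_norm f < +oo)%E &
      forall x, cube x -> has_sum (fun k => cos_coef f k * (phi k x)%:C) (f x)].

Variables (n : nat) (M : R) (z : {ffun 'I_d -> 'I_n}).

Definition hyperbolic_cross : set {ffun 'I_d -> nat} :=
  [set k | r (toZ k) <= M].

Definition tent (t : R) : R := 1 - `|2 * t - 1|.

Definition frac (t : R) : R := t - (Num.floor t)%:~R.

Definition node (i : nat) : space R d :=
  [tuple tent (frac (i%:R * (z j)%:R / n%:R)) | j < d].

(* \sum_(k \in _) is meaningful only for finitely many non-zero terms; see
   finite_hyperbolic_cross below *)
Definition algorithm f x : R[i] :=
  \sum_(k \in hyperbolic_cross)
    (n%:R^-1 * \sum_(1 <= i < n.+1) f (node i) * (phi k (node i))%:C)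
    * (phi k x)%:C.

Definition wor_error : \bar R :=
  ereal_sup [set L2norm (fun x => f x - algorithm f x) |
    f in [set f | cosine_space f /\ (cos_norm f <= 1)%E]].

Definition dual_lattice : set {ffun 'I_d -> int} :=
  [set h | (n%:Z %| \sum_(j < d) h j * (z j)%:Z)%Z].

(* s j = true stands for the sign -1 *)
Definition flip (s : {ffun 'I_d -> bool}) (h : {ffun 'I_d -> int}) :
  {ffun 'I_d -> int} := [ffun j => (-1) ^+ s j * h j].

End cosine_space.

Lemma finite_hyperbolic_cross (R : realType) d (alpha : R) (gamma : nat -> R) M :
  2^-1 < alpha -> gamma 0%N <= 1 -> (forall j, gamma j.+1 <= gamma j) ->
  (forall j, 0 < gamma j) -> finite_set (@hyperbolic_cross R d alpha gamma M).
Proof.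
move=> a2 g01 gdec g0.
have a0 : 0 < alpha by apply: lt_trans a2; rewrite invr_gt0.
have g1 j : gamma j <= 1 by elim: j => // j; exact: le_trans.
have r1_gek j (k : nat) : k%:R <= r1 alpha gamma j k%:Z.
  rewrite /r1; case: k => [|k]; first by rewrite eqxx ler01.
  have k1 : 1 <= k.+1%:R :> R by rewrite ler1n.
  apply: (@le_trans _ _ (k.+1%:R `^ (2 * alpha))).
    rewrite -[leLHS]powRr1//; apply: ler_powR => //.
    by rewrite mulrC -ler_pdivrMr// div1r ltW.
  by rewrite ler_pdivlMr// ler_piMr// powR_ge0.
have r1_ge1 j (k : nat) : 1 <= r1 alpha gamma j k%:Z.
  case: k => [|k]; first by rewrite /r1 eqxx.
  by apply: le_trans (r1_gek j k.+1); rewrite ler1n.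
pose N := (Num.truncn M).+1.
have sub : @hyperbolic_cross R d alpha gamma M `<=`
    [set [ffun j => val (g j)] | g in [set: {ffun 'I_d -> 'I_N}]].
  move=> k /= rk.
  have r1r (j : 'I_d) : r1 alpha gamma j (k j) <= M.
    apply: le_trans rk; rewrite /r (bigD1 j)//= ffunE ler_peMr//.
      exact: le_trans ler01 (r1_ge1 _ _).
    apply: (big_ind (fun t : R => 1 <= t)) => // [t u|i _].
      exact: mulr_ege1.
    by rewrite ffunE.
  have kN j : (k j < N)%N.
    have kM := le_trans (r1_gek j (k j)) (r1r j).
    by rewrite ltnS truncn_ge_nat// (le_trans _ kM).
  by exists [ffun j => Ordinal (kN j)] => //; apply/ffunP => j; rewrite !ffunE.
by apply: sub_finite_set sub _; exact: finite_image.
Qed.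

(* Main.v *)
Require Import Defs.
From mathcomp Require Import all_boot all_order all_algebra finmap.
From mathcomp Require Import complex.
From mathcomp Require Import all_classical all_reals all_analysis.
From mathcomp Require Import measurable_realfun ring lra.

(** Every [f] in the cosine space is, pointwise on the cube, the limit of its
    cosine partial sums [S], and [A f] only involves finitely many values of
    [f]; by Fatou's lemma it therefore suffices to bound the squared norm of
    [S - A S], which is a finite computation.  By orthonormality it equals
    [sum_(k \notin H_M) |u k|^2 + sum_(k \in H_M) |sum_l u l * e k l|^2], where
    [e k l] is the error of the lattice rule on [phi k * phi l].  The tent
    transform turns [cos (pi k x)] into [cos (2 pi k x)], so expanding into
    characters shows that [e k l] is [sqrt 2 ^ (|k|_0 + |l|_0)] times the
    proportion of sign pairs [(s, t)] with [s (t l - k)] a nonzero dual vector.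
    Cauchy-Schwarz with weights [r], the inequality [p^2 <= p] for a
    proportion [p], and the substitution [t l = s h + k] give the bound. *)

Set Implicit Arguments.
Unset Strict Implicit.
Unset Printing Implicit Defensive.
Import Order.TTheory GRing.Theory Num.Theory.
Import numFieldNormedType.Exports.
Local Open Scope classical_set_scope.
Local Open Scope ring_scope.

(* [space] is shadowed by the notation of mathcomp's vector.v. *)
Local Notation point R d := (d.-tuple (measurableTypeR R)).

(** * Orthonormality of the cosine basis *)

Section tensor.
Context {R : realType}.

Lemma measurable_tensor d (h : 'I_d -> R -> R) :
  (forall j, measurable_fun setT (h j)) ->
  measurable_fun setT (fun x : point R d => \prod_(j < d) h j (tnth x j)).
Proof.
move=> mh; apply: measurable_prod => j _.
exact: measurableT_comp (mh j) (measurable_tnth j).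
Qed.

(** Induction on [d]: [lebesgue d.+1] is the image under [tcons] of a product measure, so Tonelli
    gives integrability and Fubini splits off the integral of the first factor. *)
Lemma tensor_integral d (h : 'I_d -> R -> R) :
  (forall j, lebesgue_measure.-integrable setT (EFin \o h j)) ->
  let F := fun x : point R d => (\prod_(j < d) h j (tnth x j))%:E in
  (lebesgue d).-integrable setT F /\
  (\int[lebesgue d]_x F x)%E =
  (\prod_(j < d) \int[lebesgue_measure]_t h j t)%R%:E.
Proof.
elim: d h => [|d IHd] h ih F.
  have F1 : F = cst 1%:E by apply/funext => x; rewrite /F big_ord0.
  rewrite F1 big_ord0 /=; split.
    apply/integrableP; split; first exact: measurable_cst.
    under eq_integral do rewrite /= normr1.
    by rewrite integral_dirac// diracE mem_set//= mul1e ltry.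
  by rewrite integral_dirac// diracE mem_set// mul1e.
have mh j : measurable_fun setT (h j).
  by apply/measurable_EFinP; exact: measurable_int (ih j).
have mF : measurable_fun setT F by apply/measurable_EFinP; exact: measurable_tensor.
have [iG GE] := IHd (h \o lift ord0) (fun j => ih (lift ord0 j)).
set G := (fun x => _%:E) in iG GE.
have FE p : F (tcons p) = ((h ord0 p.1)%:E * G p.2)%E.
  rewrite /F /G big_ord_recl EFinM; congr (_ * _)%E; congr _%:E.
  by apply: eq_bigr => j _ /=; rewrite !(tnth_nth 0).
(* From here on [F] and [G] are known only through [FE], [mF], [iG] and [GE]. *)
clearbody F G.
pose m1 : {sigma_finite_measure set (measurableTypeR R) -> \bar R} := (@lebesgue_measure R).
have mFt : measurable_fun setT (F \o @tcons R d).
  by apply: measurableT_comp => //; exact: measurable_tcons.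
have iFt : (m1 \x lebesgue d)%E.-integrable setT (F \o @tcons R d).
  apply/integrable12ltyP => //.
  under eq_integral do under eq_integral do rewrite /= FE abseM.
  have mG : measurable_fun setT (fun y => `|G y|%E).
    by apply: measurableT_comp => //; exact: measurable_int iG.
  have -> : (\int[m1]_x \int[lebesgue d]_y (`|(h ord0 x)%:E| * `|G y|))%E =
      (\int[m1]_x (`|(h ord0 x)%:E| * \int[lebesgue d]_y `|G y|))%E.
    by apply: eq_integral => x _; rewrite ge0_integralZl.
  have /integrableP[_ h0] := ih ord0.
  have /integrableP[_ G0] := iG.
  have Gfin : (\int[lebesgue d]_y `|G y|)%E \is a fin_num.
    by rewrite ge0_fin_numE// integral_ge0.
  rewrite -(fineK Gfin) ge0_integralZr//; last 2 first.
  - by apply: measurableT_comp => //; apply/measurable_EFinP; exact: mh.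
  - by rewrite lee_fin fine_ge0// integral_ge0.
  by rewrite fineK// lte_mul_pinfty// ?integral_ge0// ge0_fin_numE// integral_ge0.
split.
  apply/integrableP; split => //.
  rewrite /= /tcons_measure ge0_integral_pushforward//; last 2 first.
  - exact: measurable_tcons.
  - exact: measurableT_comp.
  by have /integrableP[] := iFt.
rewrite [LHS](_ : _ = \int[m1 \x lebesgue d]_p (F \o @tcons R d) p)%E; last first.
  by rewrite /= /tcons_measure integral_pushforward//; exact: measurable_tcons.
rewrite -integral12_prod_meas1//= /fubini_F.
transitivity (\int[m1]_x ((h ord0 x)%:E *
    (\prod_(j < d) \int[lebesgue_measure]_t h (lift ord0 j) t)%:E))%E.
  apply: eq_integral => x _ /=.
  under eq_integral do rewrite FE/=.
  by rewrite integralZl// GE.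
rewrite integralZr//; last exact: (ih ord0).
rewrite big_ord_recl EFinM; congr (_ * _)%E.
by rewrite /Rintegral fineK//; apply: integrable_fin_num => //; exact: (ih ord0).
Qed.
End tensor.

Section cos1.
Context {R : realType}.

Lemma sin_pi_nat (m : nat) : sin (pi * m%:R) = 0 :> R.
Proof.
elim: m => [|m IHm]; first by rewrite mulr0 sin0.
by rewrite -natr1 mulrDr mulr1 sinDpi IHm oppr0.
Qed.

Lemma sin_pi_int (m : int) : sin (pi * m%:~R) = 0 :> R.
Proof.
case: m => m; first exact: sin_pi_nat.
by rewrite NegzE mulrNz mulrN sinN sin_pi_nat oppr0.
Qed.

Lemma continuous_cosZ (a : R) : continuous (fun t => cos (a * t)).
Proof.
move=> t; apply: (@continuous_comp _ _ _ ( *%R a) cos).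
  exact: mulrl_continuous.
exact: continuous_cos.
Qed.

(** For [m != 0] the antiderivative [sin (pi m t) / (pi m)] vanishes at both endpoints. The
    frequency is an integer because the product-to-sum formula produces [k - l]. *)
Lemma integral_cos (m : int) :
  \int[lebesgue_measure]_(t in `[0, 1]) cos (pi * m%:~R * t) = (m == 0)%:R :> R.
Proof.
case: eqP => [->|/eqP m0].
  under eq_Rintegral do rewrite mulr0 mul0r cos0.
  rewrite Rintegral_cst//=.
  rewrite lebesgue_measure_itv/= lte_fin ltr01 /= mul1r.
  by rewrite subr0.
pose a : R := pi * m%:~R.
have a0 : a != 0 by rewrite mulf_neq0// ?intr_eq0// gt_eqF// pi_gt0.
pose F : R -> R := fun t => a^-1 * sin (a * t).
have dF (t : R) : is_derive t (1 : R) F (cos (a * t)).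
  have h : is_derive t (1 : R) (fun t => a * t) a.
    rewrite -[X in is_derive _ _ _ X]mulr1; exact: is_deriveZ.
  have := @is_derive1_comp _ sin (fun t => a * t) t _ _ (is_derive_sin _) h.
  move=> /(@is_deriveZ _ _ _ _ a^-1 _ _); rewrite /F.
  by rewrite /GRing.scale/= mulrCA mulVf// mulr1.
have cF : continuous F.
  move=> t; apply: differentiable_continuous; apply/derivable1_diffP.
  exact: (@ex_derive _ _ _ _ _ _ _ (dF t)).
rewrite /Rintegral (@continuous_FTC2 _ (fun t => cos (a * t)) F)//.
- by rewrite /F mulr0 sin0 !mulr0 mulr1 sin_pi_int mulr0 sube0.
- by apply: continuous_subspaceT; exact: continuous_cosZ.
- split.
  + by move=> t _; exact: (@ex_derive _ _ _ _ _ _ _ (dF t)).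
  + exact/cvg_at_right_filter/cF.
  + exact/cvg_at_left_filter/cF.
- by move=> t _; rewrite derive1E; exact: (@derive_val _ _ _ _ _ _ _ (dF t)).
Qed.

(** The product-to-sum formula gives the frequencies [k - l] and [k + l], each with weight 1/2; both
    vanish exactly when [k = l = 0], which is why that value is 1. *)
Lemma integral_cosM (k l : nat) :
  \int[lebesgue_measure]_(t in `[0, 1]) (cos (pi * k%:R * t) * cos (pi * l%:R * t)) =
  (k == l)%:R * (if k == 0 then 1 else 2^-1) :> R.
Proof.
have ic (m : int) : lebesgue_measure.-integrable `[0%R, 1%R]
    (EFin \o (fun t : R => 2^-1 * cos (pi * m%:~R * t))).
  apply: continuous_compact_integrable; first exact: segment_compact.
  apply: continuous_subspaceT => t.
  apply: (@continuous_comp _ _ _ (fun t => cos (pi * m%:~R * t)) ( *%R 2^-1)).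
    exact: continuous_cosZ.
  exact: mulrl_continuous.
have ic0 (m : int) : lebesgue_measure.-integrable `[0%R, 1%R]
    (EFin \o (fun t : R => cos (pi * m%:~R * t))).
  apply: continuous_compact_integrable; first exact: segment_compact.
  by apply: continuous_subspaceT; exact: continuous_cosZ.
transitivity (\int[lebesgue_measure]_(t in `[0%R, 1%R])
    (2^-1 * cos (pi * (k%:Z - l%:Z)%:~R * t) +
     2^-1 * cos (pi * (k%:Z + l%:Z)%:~R * t)) : R).
  apply: eq_Rintegral => t _.
  rewrite intrB intrD mulrBr mulrBl mulrDr mulrDl cosB cosD.
  by field.
rewrite RintegralD// !RintegralZl// !integral_cos subr_eq0 eqz_nat.
rewrite -PoszD eqz_nat addn_eq0.
have [->|kl] := eqVneq k l.
  by case: eqP => _ /=; field.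
case: k kl => [|k]; case: l => [|l]//= _; by rewrite !mulr0 mul0r addr0.
Qed.
End cos1.

Section cube.
Context {R : realType}.

Lemma measurable_cube d : measurable (@cube R d).
Proof. exact: measurable_box. Qed.

(** Extending every factor by zero outside [[0, 1]] extends the product by zero outside the cube,
    which reduces the claim to integrals over the whole space. *)
Lemma cube_tensor_integral d (g : 'I_d -> R -> R) :
  (forall j, continuous (g j)) ->
  let F := fun x : point R d => \prod_(j < d) g j (tnth x j) in
  (lebesgue d).-integrable (@cube R d) (EFin \o F) /\
  \int[lebesgue d]_(x in @cube R d) F x =
  \prod_(j < d) \int[lebesgue_measure]_(t in `[0, 1]) g j t.
Proof.
move=> cg F.
pose h j := g j \_ `[0, 1]%classic.
have FE : (fun x => (F x)%:E) \_ (@cube R d) =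
    (fun x : point R d => (\prod_(j < d) h j (tnth x j))%:E).
  apply/funext => x; rewrite /patch; case: ifPn => [/set_mem xc|xc].
    congr _%:E; apply: eq_bigr => j _; rewrite /h /patch mem_set//=.
    by rewrite in_itv /=; exact: xc.
  have [j xj] : exists j, ~ (0 <= tnth x j <= 1).
    apply/existsNP => h1; move/negP: xc; apply; apply/mem_set => j.
    exact: h1.
  rewrite (bigD1 j)//= /h /patch memNset ?mul0r//=.
have ih j : lebesgue_measure.-integrable setT (EFin \o h j).
  rewrite (_ : EFin \o h j = (EFin \o g j) \_ `[0, 1]%classic); last first.
    by apply/funext => t; rewrite /h /patch /=; case: ifP.
  rewrite -integrable_mkcond//.
  apply: continuous_compact_integrable; first exact: segment_compact.
  by apply: continuous_subspaceT; exact: cg.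
have [iF FI] := tensor_integral ih.
split.
  by apply/integrable_mkcond; [exact: measurable_cube|rewrite FE].
rewrite [LHS]/Rintegral integral_mkcond FE FI/=.
by apply: eq_bigr => j _; rewrite [RHS]Rintegral_mkcond.
Qed.

Lemma measurable_phi d (k : {ffun 'I_d -> nat}) (D : set (point R d)) :
  measurable_fun D (@phi R d k).
Proof.
apply: measurable_funS (@measurableT _ _) (@subsetT _ D) _.
apply: measurable_funM; first exact: measurable_cst.
apply: (@measurable_tensor R d (fun j t => cos (pi * (k j)%:R * t))) => j.
by apply: continuous_measurable_fun; exact: continuous_cosZ.
Qed.

Lemma phiM d (k l : {ffun 'I_d -> nat}) :
  (fun x => @phi R d k x * phi l x) =
  (fun x => (Num.sqrt 2 ^+ nnz (toZ k) * Num.sqrt 2 ^+ nnz (toZ l)) *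
   \prod_(j < d) (cos (pi * (k j)%:R * tnth x j) * cos (pi * (l j)%:R * tnth x j))).
Proof.
by apply/funext => x; rewrite big_split /phi /= mulrACA.
Qed.

Lemma prod_if_nnz d (k : {ffun 'I_d -> nat}) (a : R) :
  \prod_(j < d) (if k j == 0 then 1 else a) = a ^+ nnz (toZ k).
Proof.
under eq_bigr do rewrite -if_neg.
rewrite -big_mkcond/= prodr_const; congr (_ ^+ _).
rewrite /nnz cardsE; apply: eq_card => j.
by rewrite /in_mem /= ffunE eqz_nat.
Qed.

(** The normalisation by powers of [sqrt 2] compensates one factor 1/2 per non-zero component. If
    [k != l], a coordinate where they differ annihilates the product. *)
Lemma phi_orthonormal d (k l : {ffun 'I_d -> nat}) :
  (lebesgue d).-integrable (@cube R d) (EFin \o (fun x => phi k x * phi l x)) /\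
  \int[lebesgue d]_(x in @cube R d) (phi k x * phi l x) = (k == l)%:R.
Proof.
have cc j : continuous (fun t : R => cos (pi * (k j)%:R * t) * cos (pi * (l j)%:R * t)).
  move=> t; apply: continuousM; exact: continuous_cosZ.
have [i1 i2] := cube_tensor_integral cc.
rewrite phiM; split.
  have := integrableZl (@measurable_cube d)
    (Num.sqrt 2 ^+ nnz (toZ k) * Num.sqrt 2 ^+ nnz (toZ l)) i1.
  apply: eq_integrable; first exact: measurable_cube.
  by [].
rewrite RintegralZl//; last exact: measurable_cube.
rewrite i2; under eq_bigr do rewrite integral_cosM.
have [->|kl] := eqVneq k l.
  under eq_bigr do rewrite eqxx mul1r.
  rewrite prod_if_nnz -exprD addnn -mul2n exprM sqr_sqrtr// exprVn mulfV//.
have [j kj] : exists j, k j != l j.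
  by apply/existsP; rewrite -negb_forall; apply: contraNN kl => /forallP h;
     apply/eqP/ffunP => j; apply/eqP.
by rewrite (bigD1 j)//= (negbTE kj) !mul0r mulr0.
Qed.

(** Parseval's identity for finite sums: of the expanded square only the diagonal terms survive. *)
Lemma integral_sum_phi d (s : seq {ffun 'I_d -> nat}) (a : {ffun 'I_d -> nat} -> R) :
  uniq s ->
  (\int[lebesgue d]_(x in @cube R d) ((\sum_(k <- s) a k * phi k x) ^+ 2)%:E)%E =
  (\sum_(k <- s) a k ^+ 2)%:E.
Proof.
move=> us.
have mc := @measurable_cube d.
pose f i j x := (a i * a j * (@phi R d i x * phi j x))%:E.
have fi i j : (lebesgue d).-integrable (@cube R d) (f i j).
  have := integrableZl mc (a i * a j) (phi_orthonormal i j).1.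
  exact: eq_integrable.
transitivity (\int[lebesgue d]_(x in @cube R d) \sum_(i <- s) \sum_(j <- s) f i j x)%E.
  apply: eq_integral => x _; rewrite expr2 big_distrlr /= -sumEFin.
  apply: eq_bigr => i _; rewrite -sumEFin; apply: eq_bigr => j _.
  by rewrite /f mulrACA.
rewrite integral_sum//; last by move=> i; exact: integrable_sum.
rewrite -sumEFin; apply: eq_big_seq => i si.
rewrite integral_sum// (bigD1_seq i)//= big1 ?adde0 => [|j ji].
  rewrite /f; have [i1 i2] := phi_orthonormal i i.
  rewrite -[LHS]fineK; last exact: integrable_fin_num (fi i i).
  congr _%:E; rewrite [LHS](_ : _ =
    \int[lebesgue d]_(x in @cube R d) (a i * a i * (phi i x * phi i x)))//.
  by rewrite RintegralZl// i2 eqxx mulr1 expr2.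
have [i1 i2] := phi_orthonormal i j.
rewrite -[LHS]fineK; last exact: integrable_fin_num (fi i j).
congr _%:E; rewrite [LHS](_ : _ =
  \int[lebesgue d]_(x in @cube R d) (a i * a j * (phi i x * phi j x)))//.
by rewrite RintegralZl// i2 eq_sym (negbTE ji) mulr0.
Qed.
End cube.

(** * Lattice rules on products of cosines *)

Local Open Scope complex_scope.

(** * Characters: orthogonality and expansion of cosine products *)

Section cis.
Context {R : realType}.
Implicit Types a b t : R.

Definition cis t : R[i] := cos t +i* sin t.

Lemma cis0 : cis 0 = 1.
Proof. by rewrite /cis cos0 sin0. Qed.

Lemma cisD a b : cis (a + b) = cis a * cis b.
Proof. by rewrite /cis cosD sinD /GRing.mul /= [cos a * sin b + _]addrC. Qed.

Lemma cis_sum (I : Type) (s : seq I) (P : pred I) (a : I -> R) :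
  cis (\sum_(i <- s | P i) a i) = \prod_(i <- s | P i) cis (a i).
Proof. by apply: (big_morph cis); [exact: cisD|exact: cis0]. Qed.

Lemma cisX n a : cis (n%:R * a) = cis a ^+ n.
Proof.
elim: n => [|n IHn]; first by rewrite mul0r cis0 expr0.
by rewrite -natr1 mulrDl mul1r cisD IHn exprSr.
Qed.

Lemma cis_2piM (m : int) : cis (2 * pi * m%:~R) = 1.
Proof.
have cn (k : nat) : cis (2 * pi * k%:R) = 1.
  have -> : 2 * pi * k%:R = k%:R * (2 * pi) :> R by rewrite mulrC.
  rewrite cisX /cis mulrC mulr_natr.
  by rewrite cos2pi sin2pi expr1n.
case: m => k; first exact: cn.
have := cn k.+1; rewrite NegzE mulrNz mulrN /cis cosN sinN => -[-> ->].
by rewrite oppr0.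
Qed.

(** Only the residue [q] of [m] matters, and [0 < q < n]. A value 1 would force
    [sin (pi q / n) = 0], although [pi q / n] lies strictly between 0 and [pi]. *)
Lemma cis_neq1 (n : nat) (m : int) : (0 < n)%N -> ~~ (n%:Z %| m)%Z ->
  cis (2 * pi * m%:~R / n%:R) != 1.
Proof.
move=> n0 nm.
have nR0 : 0 < n%:R :> R by rewrite ltr0n.
have nz0 : n%:Z != 0 by rewrite eqz_nat -lt0n.
have mod0 : (m %% n)%Z != 0.
  by apply: contraNN nm => /eqP/dvdz_mod0P.
have mod_ge : 0 <= (m %% n)%Z by exact: modz_ge0.
have mod_lt : (m %% n)%Z < n%:Z by rewrite ltz_pmod// ltz_nat.
rewrite [m in X in cis X](divz_eq m n%:Z) intrD intrM mulrDr mulrDl.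
have nRz : n%:R != 0 :> R by rewrite gt_eqF.
rewrite mulrA mulfK// cisD cis_2piM mul1r.
set q := (m %% n)%Z in mod0 mod_ge mod_lt *.
apply/negP => /eqP/(congr1 (@complex.Re R))/= c1.
have : 2 * pi * q%:~R / n%:R = (pi * q%:~R / n%:R) *+ 2 :> R.
  by rewrite -!mulrA mulr_natl.
move=> h; move: c1; rewrite h cos_mulr2n cos2sin2 => c1.
have : 0 < sin (pi * q%:~R / n%:R : R).
  apply: sin_gt0_pi; apply/andP; split.
    rewrite divr_gt0// mulr_gt0// ?pi_gt0// ltr0z.
    by rewrite lt_def mod0.
  rewrite ltr_pdivrMr// ltr_pM2l ?pi_gt0//.
  by rewrite -[n%:R]/(n%:Z%:~R) ltr_int.
move=> s0; have := exprn_gt0 2 s0; lra.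
Qed.

(** The summands are the powers of an [n]-th root of unity [w]. Either [w = 1], or the geometric sum
    vanishes because [w ^+ n - 1 = 0] and [w - 1] is invertible. *)
Lemma mean_cis (n : nat) (m : int) : (0 < n)%N ->
  n%:R^-1 * \sum_(1 <= i < n.+1) cis (2 * pi * (i%:R * m%:~R / n%:R)) =
  ((n%:Z %| m)%Z)%:R.
Proof.
move=> n0.
have nC : n%:R != 0 :> R[i] by rewrite pnatr_eq0 -lt0n.
have nR : n%:R != 0 :> R by rewrite pnatr_eq0 -lt0n.
set w := cis (2 * pi * m%:~R / n%:R).
have wE i : cis (2 * pi * (i%:R * m%:~R / n%:R)) = w ^+ i.
  by rewrite -cisX; congr cis; ring.
under eq_bigr do rewrite wE.
have wn : w ^+ n = 1.
  by rewrite -cisX mulrC divfK// cis_2piM.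
case: (boolP (n%:Z %| m)%Z) => [/dvdzP[q mq]|nm].
  have w1 : w = 1.
    by rewrite /w mq intrM -[n%:Z%:~R]/(n%:R) mulrA mulfK// cis_2piM.
  under eq_bigr do rewrite w1 expr1n.
  by rewrite sumr_const_nat subn1/= mulVf.
have w1 := cis_neq1 n0 nm; rewrite -/w in w1.
rewrite big_add1/= big_mkord.
under eq_bigr do rewrite exprS.
rewrite -mulr_sumr.
have : (w - 1) * \sum_(i < n) w ^+ i = 0 by rewrite -subrX1 wn subrr.
move/eqP; rewrite mulf_eq0 subr_eq0 (negbTE w1)/= => /eqP->.
by rewrite !mulr0.
Qed.

(** In each coordinate the product of two cosines is the mean of four characters: [t] provides the
    sum and the difference of the angles, and [s] cancels the sines. Distributing the product over
    the sums gives sign vectors. *)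
Lemma prod_cosM d (a b : 'I_d -> R) :
  (\prod_(j < d) (cos (a j) * cos (b j)))%:C =
  4%:R ^- d * \sum_(s : {ffun 'I_d -> bool}) \sum_(t : {ffun 'I_d -> bool})
    cis (\sum_(j < d) (-1) ^+ s j * ((-1) ^+ t j * b j - a j)).
Proof.
rewrite rmorph_prod/=.
pose F j (s t : bool) := cis ((-1) ^+ s * ((-1) ^+ t * b j - a j)).
have FE j : (cos (a j) * cos (b j))%:C = 4^-1 * \sum_s \sum_t F j s t.
  rewrite !big_bool/= /F /= expr0 expr1 !mul1r !mulN1r.
  rewrite /cis !(cosD, sinD, cosN, sinN).
  have C4 : (4 : R[i]) != 0 by rewrite pnatr_eq0.
  apply: (mulfI C4); rewrite mulVKf// -[LHS]/(4%:R * _).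
  rewrite -(rmorph_nat (real_complex R)) -rmorphM /=.
  by apply/eqP; rewrite eq_complex /=; apply/andP; split; apply/eqP; ring.
under eq_bigr do rewrite FE.
rewrite big_split/= prodr_const card_ord exprVn; congr (_ * _).
rewrite bigA_distr_bigA/=; apply: eq_bigr => s _.
rewrite bigA_distr_bigA/=; apply: eq_bigr => t _.
by rewrite cis_sum.
Qed.
End cis.

(* [frac] is shadowed by mathcomp's fraction.v. *)
Local Notation frac := Defs.frac.

(** * The tent transform doubles the frequency of a cosine *)

Section tent.
Context {R : realType}.
Implicit Types t : R.

Lemma frac_itv t : 0 <= frac t < 1.
Proof.
by have /andP[] := floor_itv t; rewrite intrD => ? ?; rewrite /frac; lra.
Qed.

Lemma tent_itv t : 0 <= t <= 1 -> 0 <= tent t <= 1.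
Proof.
move=> t01; rewrite /tent subr_ge0 ler_norml.
by rewrite gerBl normr_ge0 andbT; lra.
Qed.

Lemma cos_periodic_int (m : int) t : cos (t + 2 * pi * m%:~R) = cos t.
Proof.
have h := @cis_2piM R m.
have c := congr1 (@complex.Re R) h; have s := congr1 (@complex.Im R) h.
rewrite /= in c s.
by rewrite cosD c s mulr1 mulr0 subr0.
Qed.

Lemma cos_tent_frac (k : nat) t :
  cos (pi * k%:R * tent (frac t)) = cos (2 * pi * k%:R * t).
Proof.
have -> : cos (2 * pi * k%:R * t) = cos (2 * pi * k%:R * frac t).
  rewrite -(cos_periodic_int (k%:Z * Num.floor t) (2 * pi * k%:R * frac t)).
  by congr cos; rewrite /frac intrM -[k%:Z%:~R]/(k%:R); ring.
set y := frac t; rewrite /tent.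
(* On the right half [tent y = 2 - 2 * y], and evenness and periodicity remove the reflection; on
   the left half [tent y = 2 * y]. *)
case: ger0P => _.
  rewrite -cosN -(cos_periodic_int k).
  by congr cos; rewrite -[k%:Z%:~R]/(k%:R); ring.
by congr cos; ring.
Qed.
End tent.

(** * Lattice rules as counts of dual vectors *)

Section lattice.
Context {R : realType} (d n : nat) (z : {ffun 'I_d -> 'I_n}).
Hypothesis n_gt0 : (0 < n)%N.
Implicit Types k l : {ffun 'I_d -> nat}.

Lemma node_cube i : cube (@node R d n z i).
Proof.
move=> j; rewrite tnth_mktuple; apply: tent_itv.
by have /andP[-> /ltW] := frac_itv (i%:R * (z j)%:R / n%:R : R).
Qed.

(** This is the [k]-th coefficient that the algorithm assigns to [phi l]. *)
Definition quad k l : R :=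
  n%:R^-1 * \sum_(1 <= i < n.+1) phi l (@node R d n z i) * phi k (node z i).

(** Divided by [4 ^ d] this is a proportion of sign pairs. The set [D] is a parameter so that the
    zero vector can be split off the dual lattice. *)
Definition lattice_count (D : set {ffun 'I_d -> int}) k l : R :=
  \sum_(s : {ffun 'I_d -> bool}) \sum_(t : {ffun 'I_d -> bool})
    (flip s (flip t (toZ l) - toZ k) \in D)%:R.

Lemma phi_nodeM k l i :
  phi l (@node R d n z i) * phi k (node z i) =
  Num.sqrt 2 ^+ nnz (toZ k) * Num.sqrt 2 ^+ nnz (toZ l) *
  \prod_(j < d) (cos (2 * pi * (k j)%:R * (i%:R * (z j)%:R / n%:R)) *
                 cos (2 * pi * (l j)%:R * (i%:R * (z j)%:R / n%:R))).
Proof.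
rewrite mulrC big_split /= mulrACA /phi.
by congr (_ * _ * (_ * _)); apply: eq_bigr => j _; rewrite tnth_mktuple cos_tent_frac.
Qed.

(** Along the nodes, each sign pair contributes a character whose mean is 1 or 0 according to
    whether its frequency vector is in the dual lattice. *)
Lemma quadE k l : quad k l =
  Num.sqrt 2 ^+ nnz (toZ k) * Num.sqrt 2 ^+ nnz (toZ l) *
  (4%:R ^- d * lattice_count (dual_lattice z) k l).
Proof.
rewrite /quad; under eq_bigr do rewrite phi_nodeM.
rewrite -mulr_sumr mulrCA; congr (_ * _).
(* The real identity is checked in the complex numbers, where the characters take their values. *)
apply: (@complexI R); rewrite !rmorphM !rmorphV ?unitfE ?pnatr_eq0 -?lt0n//.
rewrite rmorphXn/= !rmorph_nat rmorph_sum/=.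
under eq_bigr do rewrite prod_cosM.
rewrite -mulr_sumr mulrCA; congr (_ * _).
rewrite exchange_big mulr_sumr rmorph_sum/=; apply: eq_bigr => s _.
rewrite exchange_big mulr_sumr rmorph_sum/=; apply: eq_bigr => t _.
set h := flip s _.
transitivity (n%:R^-1 * \sum_(1 <= i < n.+1)
   cis (2 * pi * (i%:R * (\sum_(j < d) h j * (z j)%:Z)%:~R / n%:R)) : R[i]).
  congr (_ * _); apply: eq_bigr => i _; congr cis.
  rewrite rmorph_sum/= mulr_sumr mulr_suml mulr_sumr.
  apply: eq_bigr => j _; rewrite /h !ffunE !rmorphM rmorphB rmorphM /= !rmorph_sign.
  rewrite -[(k j)%:Z%:~R]/((k j)%:R) -[(l j)%:Z%:~R]/((l j)%:R).
  by rewrite -[(z j)%:Z%:~R]/((z j)%:R); ring.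
rewrite mean_cis// rmorph_nat; congr (_%:R); congr nat_of_bool.
by apply/idP/idP => [?|/set_mem//]; exact/mem_set.
Qed.

Lemma lattice_countD k l : lattice_count (dual_lattice z) k l =
  lattice_count (dual_lattice z `\ 0%R) k l + lattice_count [set 0%R] k l.
Proof.
rewrite /lattice_count -big_split; apply: eq_bigr => s _ /=.
rewrite -big_split; apply: eq_bigr => t _ /=.
set h := flip s _; have [->|h0] := eqVneq h 0.
  rewrite [X in _ = (nat_of_bool X)%:R + _]memNset ?add0r; last by case=> _; apply.
  rewrite !mem_set// /dual_lattice /= big1// => j _.
  by rewrite ffunE mul0r.
rewrite [X in _ = _ + (nat_of_bool X)%:R]memNset ?addr0//=; last exact/eqP.
congr (_%:R); congr nat_of_bool.
apply/idP/idP => /set_mem; last by move=> [? _]; exact/mem_set.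
by move=> ?; apply/mem_set; split => //; exact/eqP.
Qed.
End lattice.

(** * Counting sign changes *)

Section flips.
Context {d : nat}.
Implicit Types (s t : {ffun 'I_d -> bool}) (h m : {ffun 'I_d -> int}).
Implicit Types (k l : {ffun 'I_d -> nat}).

Lemma flipK s : involutive (@flip d s).
Proof. by move=> h; apply/ffunP => j; rewrite !ffunE mulrA -expr2 sqrr_sign mul1r. Qed.

Lemma flip0 s : flip s 0 = 0.
Proof. by apply/ffunP => j; rewrite !ffunE mulr0. Qed.

Definition absff h : {ffun 'I_d -> nat} := [ffun j => `|h j|%N].

Lemma absff_flip s l : absff (flip s (toZ l)) = l.
Proof. by apply/ffunP => j; rewrite !ffunE abszMsign. Qed.

(** A sign matters only at a non-zero component of [l], where it must agree with that of [s]; at a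
    zero component both signs are allowed. The multiplied form avoids the exponent
    [d - nnz (toZ l)]. *)
Lemma sum_flip_eq (R : realType) l s :
  2 ^+ nnz (toZ l) * \sum_t (flip t (toZ l) == flip s (toZ l))%:R = 2 ^+ d :> R.
Proof.
have E t : (flip t (toZ l) == flip s (toZ l))%:R =
    \prod_(j < d) ((-1) ^+ t j * (l j)%:Z == (-1) ^+ s j * (l j)%:Z)%:R :> R.
  have [/ffunP e|ne] := eqVneq.
    by rewrite big1// => j _; have := e j; rewrite !ffunE => ->; rewrite eqxx.
  have [j ej] : exists j, flip t (toZ l) j != flip s (toZ l) j.
    apply/existsP; rewrite -negb_forall; apply: contraNN ne => /forallP e.
    by apply/eqP/ffunP => j; apply/eqP.
  by rewrite (bigD1 j)//=; rewrite !ffunE in ej; rewrite (negbTE ej) mul0r.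
under eq_bigr do rewrite E.
rewrite -(bigA_distr_bigA (fun j (b : bool) =>
  ((-1) ^+ b * (l j)%:Z == (-1) ^+ s j * (l j)%:Z)%:R : R))/=.
rewrite -prod_if_nnz -big_split/= -[RHS](_ : \prod_(j < d) 2 = _); last first.
  by rewrite prodr_const card_ord.
apply: eq_bigr => j _; rewrite big_bool/= expr0 expr1 mulN1r mul1r.
case: ifPn => [/eqP->|lj]; first by rewrite oppr0 mulr0 eqxx mul1r.
have lj0 : (l j)%:Z != 0 by rewrite eqz_nat.
have lN : (- (l j)%:Z == (l j)%:Z) = false.
  by rewrite eqNr (negbTE lj0).
have lN' : ((l j)%:Z == - (l j)%:Z) = false by rewrite eq_sym.
by case: (s j); rewrite ?expr0 ?expr1 ?mulN1r ?mul1r eqxx ?lN ?lN' ?addr0 ?add0r mulr1.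
Qed.
End flips.

Section errors.
Context {R : realType} (d n : nat) (z : {ffun 'I_d -> 'I_n}).
Hypothesis n_gt0 : (0 < n)%N.
Implicit Types k l : {ffun 'I_d -> nat}.

(** The zero vector arises exactly when [flip t (toZ l) = toZ k], and absolute values then give
    [l = k]. In that case [s] is free, with [2 ^ d] choices, and [sum_flip_eq] counts the admissible
    [t]. *)
Lemma lattice_count0 k l :
  2 ^+ nnz (toZ k) * @lattice_count R d [set 0%R] k l = 4 ^+ d * (k == l)%:R.
Proof.
have E s t : (flip s (flip t (toZ l) - toZ k) \in [set 0%R]) = (flip t (toZ l) == toZ k).
  apply/idP/eqP => [/set_mem/= /(congr1 (flip s))|->]; last first.
    by apply/mem_set; rewrite subrr /= flip0.
  by rewrite flipK flip0 => /subr0_eq.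
rewrite /lattice_count; under eq_bigr do under eq_bigr do rewrite E.
rewrite sumr_const card_ffun card_bool card_ord.
have [<-|kl] := eqVneq k l; last first.
  rewrite mulr0 big1 ?mul0rn ?mulr0// => t _.
  case: eqP => // /(congr1 absff); rewrite absff_flip => lk; case/eqP: kl.
  by rewrite lk; apply/ffunP => j; rewrite !ffunE.
(* The trivial sign vector brings the count into the form of [sum_flip_eq]. *)
have h0 : toZ k = flip [ffun=> false] (toZ k).
  by apply/ffunP => j; rewrite !ffunE expr0 mul1r.
rewrite -[X in _ * X]mulr_natr mulrA.
rewrite (_ : \sum_t _ = \sum_t (flip t (toZ k) == flip [ffun=> false] (toZ k))%:R); last first.
  by apply: eq_bigr => t _; rewrite -h0.
by rewrite sum_flip_eq natrX -exprMn mulr1; congr (_ ^+ _); ring.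
Qed.

(* The zero dual vector contributes exactly [(k == l)%:R] to [quad z k l]. *)
Definition quad_err k l : R :=
  Num.sqrt 2 ^+ nnz (toZ k) * Num.sqrt 2 ^+ nnz (toZ l) *
  (4%:R ^- d * lattice_count (dual_lattice z `\ 0%R) k l).

Lemma quad_split k l : quad z k l = (k == l)%:R + quad_err k l.
Proof.
rewrite quadE// lattice_countD mulrDr mulrDr addrC; congr (_ + _).
have := lattice_count0 k l; have [<-|kl] := eqVneq k l => /=.
  rewrite -expr2 -exprM mulnC exprM sqr_sqrtr// => h.
  by rewrite mulrCA h mulr1 mulVf.
rewrite mulr0 => /eqP; rewrite mulf_eq0 expf_eq0 pnatr_eq0 andbF/= => /eqP->.
by rewrite !mulr0.
Qed.

Lemma lattice_count_itv D k l : 0 <= 4%:R ^- d * @lattice_count R d D k l <= 1.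
Proof.
apply/andP; split.
  apply: mulr_ge0; rewrite ?invr_ge0 ?exprn_ge0//.
  by apply: sumr_ge0 => s _; apply: sumr_ge0.
rewrite ler_pdivrMl ?exprn_gt0// mulr1.
apply: (@le_trans _ _ (\sum_(s : {ffun 'I_d -> bool})
  \sum_(t : {ffun 'I_d -> bool}) 1)).
  by apply: ler_sum => s _; apply: ler_sum => t _; rewrite lern1 leq_b1.
rewrite !sumr_const card_ffun card_bool card_ord -mulrnA -expnMn.
by rewrite natrX.
Qed.

(* The proportion [p] of sign pairs satisfies [p ^+ 2 <= p]. *)
Lemma quad_err_sqr k l : quad_err k l ^+ 2 <=
  2 ^+ nnz (toZ k) * 2 ^+ nnz (toZ l) *
  (4%:R ^- d * lattice_count (dual_lattice z `\ 0%R) k l).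
Proof.
rewrite /quad_err !exprMn -!exprM ![(_ * 2)%N]mulnC !exprM sqr_sqrtr//.
rewrite ler_wpM2l// ?mulr_ge0 ?exprn_ge0//.
have /andP[p0 p1] := lattice_count_itv (dual_lattice z `\ 0%R) k l.
by rewrite -exprMn expr2 ler_piMr.
Qed.

End errors.

Lemma sum_le_esum (R : realType) (T : choiceType) (s : seq T) (P : set T) (a : T -> \bar R) :
  uniq s -> (\sum_(i <- s | i \in P) a i <= \esum_(i in P) a i)%E.
Proof.
move=> us; apply: esum_ge.
exists [set` [seq i <- s | i \in P]].
  split; first exact: finite_seq.
  by move=> i /=; rewrite mem_filter => /andP[/set_mem].
by rewrite -big_filter fsbig_seq// filter_uniq.
Qed.

(** * Summing the quadrature errors against the weights *)

Section weights.
Context {R : realType} (d n : nat) (z : {ffun 'I_d -> 'I_n}).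
Variables (alpha : R) (gamma : nat -> R).
Hypothesis gamma_gt0 : forall j, 0 < gamma j.
Implicit Types k l : {ffun 'I_d -> nat}.

Lemma r_gt0 (h : {ffun 'I_d -> int}) : 0 < r alpha gamma h.
Proof.
apply: prodr_gt0 => j _; rewrite /r1; case: ifPn => // h0.
by rewrite divr_gt0// powR_gt0// ltr0z normr_gt0.
Qed.

Lemma r_flip s (h : {ffun 'I_d -> int}) : r alpha gamma (flip s h) = r alpha gamma h.
Proof.
apply: eq_bigr => j _; rewrite /r1 ffunE mulf_eq0 signr_eq0/=.
by rewrite normrM normr_sign mul1r.
Qed.

(* For fixed [m], only [l = absff m] contributes, with total weight 1. *)
Lemma sum_flip_le1 (F : seq {ffun 'I_d -> nat}) (m : {ffun 'I_d -> int}) : uniq F ->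
  \sum_(l <- F) \sum_(t : {ffun 'I_d -> bool})
    (2 ^+ nnz (toZ l) * 2 ^- d * (flip t (toZ l) == m)%:R) <= 1 :> R.
Proof.
move=> uF.
apply: (@le_trans _ _ (\sum_(l <- F) (l == absff m)%:R)).
  apply: ler_sum => l _; rewrite -mulr_sumr.
  have [/existsP[t /eqP <-]|/existsPn no] := boolP [exists t, flip t (toZ l) == m].
    by rewrite absff_flip eqxx mulrAC sum_flip_eq mulfV.
  by rewrite big1 ?mulr0// => t _; rewrite (negbTE (no t)).
rewrite -natr_sum lern1 (_ : bigop _ _ _ = count_mem (absff m) F).
  by rewrite count_uniq_mem// leq_b1.
by rewrite -sum1_count [RHS]big_mkcond; apply: eq_bigr => l _ /=; case: eqP.
Qed.

(** The substitution [m = flip s h + toZ k], with inverse [h = flip s (m - toZ k)], moves the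
    dependence on [s] from the summand to the index set. *)
Lemma esum_flip s k :
  (\esum_(h in dual_lattice z `\ 0%R)
     (2 ^+ nnz (toZ k) / (2 ^+ d * r alpha gamma (flip s h + toZ k)))%R%:E =
   \esum_(m in [set m : {ffun 'I_d -> int} |
                 flip s (m - toZ k)%R \in dual_lattice z `\ 0%R])
     (2 ^+ nnz (toZ k) / (2 ^+ d * r alpha gamma m))%R%:E)%E.
Proof.
rewrite (@reindex_esum _ _ _ [set m : {ffun 'I_d -> int} |
                               flip s (m - toZ k)%R \in dual_lattice z `\ 0%R]
  _ (fun m => flip s (m - toZ k))); last first.
  split.
  - by move=> m /= /set_mem.
  - by move=> m m' _ _ /(inv_inj (flipK s))/addIr.
  - move=> h hD; exists (flip s h + toZ k); last by rewrite addrK flipK.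
    by rewrite /= addrK flipK; exact/mem_set.
by apply: eq_esum => m _; rewrite flipK subrK.
Qed.

(** Each [t] turns [l] into a vector [m = flip t (toZ l)] of the same weight [r]. By [quad_err_sqr]
    the left side is then at most a sum over [s] and [m] of terms from the right side, each
    multiplied by [W m], and [W m <= 1] by [sum_flip_le1]. *)
Lemma sum_quad_err (F : seq {ffun 'I_d -> nat}) k : uniq F ->
  ((\sum_(l <- F) quad_err z k l ^+ 2 / r alpha gamma (toZ l))%:E <=
   \esum_(h in dual_lattice z `\ 0%R)
       (\sum_(s : {ffun 'I_d -> bool})
         2 ^+ nnz (toZ k) /
         (2 ^+ d * r alpha gamma (flip s h + toZ k)))%R%:E)%E.
Proof.
move=> uF.
have w0 (h : {ffun 'I_d -> int}) :
    0 <= 2 ^+ nnz (toZ k) / (2 ^+ d * r alpha gamma h) :> R.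
  by rewrite divr_ge0 ?exprn_ge0// mulr_ge0 ?exprn_ge0//; exact/ltW/r_gt0.
under eq_esum do rewrite -sumEFin.
rewrite esum_sum; last by move=> h s _ _; rewrite lee_fin.
under [leRHS]eq_bigr do rewrite esum_flip.
pose P s := [set m : {ffun 'I_d -> int} |
                flip s (m - toZ k)%R \in dual_lattice z `\ 0%R].
(* All sign variants of the indices in [F]: the finitely many [m] that the left side can reach. *)
pose U := undup [seq flip t (toZ l) | l <- F, t <- enum {ffun 'I_d -> bool}].
pose g s (m : {ffun 'I_d -> int}) : R :=
  (m \in P s)%:R * (2 ^+ nnz (toZ k) / (2 ^+ d * r alpha gamma m)).
have g0 s m : 0 <= g s m by rewrite mulr_ge0.
apply: (@le_trans _ _ (\sum_s \sum_(m <- U) g s m)%:E); last first.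
  rewrite -sumEFin; apply: lee_sum => s _.
  apply: le_trans (sum_le_esum _ _ (undup_uniq _ : uniq U)).
  rewrite [leRHS]big_mkcond -sumEFin le_eqVlt; apply/orP; left; apply/eqP.
  by apply: eq_bigr => m _; rewrite /g; case: ifP => _; rewrite ?mul1r ?mul0r.
rewrite lee_fin.
pose W (m : {ffun 'I_d -> int}) : R := \sum_(l <- F) \sum_(t : {ffun 'I_d -> bool})
    (2 ^+ nnz (toZ l) * 2 ^- d * (flip t (toZ l) == m)%:R).
apply: (@le_trans _ _ (\sum_s \sum_(m <- U) g s m * W m)); last first.
  apply: ler_sum => s _; apply: ler_sum => m _.
  by rewrite ler_piMr// sum_flip_le1.
rewrite /W; under [leRHS]eq_bigr do under eq_bigr do rewrite mulr_sumr.
under [leRHS]eq_bigr do rewrite exchange_big.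
(* With [l] outermost the comparison is made for each [l] separately; membership in [F] guarantees
   that [flip t (toZ l)] occurs in [U]. *)
rewrite [leRHS]exchange_big/= big_seq [leRHS]big_seq; apply: ler_sum => l lF.
rewrite ler_pdivrMr ?r_gt0//; apply: le_trans (quad_err_sqr _ _ _) _.
rewrite le_eqVlt; apply/orP; left; apply/eqP.
rewrite /lattice_count !mulr_sumr mulr_suml; apply: eq_bigr => s _.
rewrite !mulr_sumr.
under [in RHS]eq_bigr do rewrite mulr_sumr.
rewrite exchange_big mulr_suml; apply: eq_bigr => t _ /=.
rewrite (bigD1_seq (flip t (toZ l))) ?undup_uniq//=; last first.
  by rewrite mem_undup; apply/allpairsP; exists (l, t); rewrite mem_enum.
rewrite big1 ?addr0 => [|m /negbTE ml]; last by rewrite eq_sym ml !mulr0.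
have r0 := r_gt0 (toZ l); rewrite /g r_flip eqxx mulr1.
rewrite [_ \in P s](_ : _ =
  (flip s (flip t (toZ l) - toZ k) \in dual_lattice z `\ 0%R)); last first.
  by apply/idP/idP => [/set_mem//|?]; exact/mem_set.
rewrite (_ : 4 = 2 * 2) ?exprMn; last by ring.
set b := _%:R; field.
by rewrite expf_neq0 ?pnatr_eq0// gt_eqF.
Qed.
End weights.

(** * The residual of a cosine polynomial *)

Lemma weighted_cauchy_schwarz (R : realFieldType) (I : Type) (s : seq I) (a b w : I -> R) :
  (forall i, 0 < w i) ->
  (\sum_(i <- s) a i * b i) ^+ 2 <=
  (\sum_(i <- s) a i ^+ 2 * w i) * (\sum_(i <- s) b i ^+ 2 / w i).
Proof.
move=> w0; elim: s => [|i s IHs]; first by rewrite !big_nil expr2 !mulr0.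
rewrite !big_cons; move: IHs.
have : 0 <= \sum_(j <- s) a j ^+ 2 * w j.
  by apply: sumr_ge0 => j _; rewrite mulr_ge0 ?sqr_ge0// ltW.
have : 0 <= \sum_(j <- s) b j ^+ 2 / w j.
  by apply: sumr_ge0 => j _; rewrite divr_ge0 ?sqr_ge0// ltW.
move: (\sum_(j <- s) _) (\sum_(j <- s) _) (\sum_(j <- s) _) => S A B B0 A0 SAB.
set p := b i ^+ 2 / w i; set q := a i ^+ 2 * w i.
have p0 : 0 <= p by rewrite divr_ge0 ?sqr_ge0// ltW.
have q0 : 0 <= q by rewrite mulr_ge0 ?sqr_ge0// ltW.
have pq : (a i * b i) ^+ 2 = q * p.
  by rewrite /p /q; field; rewrite gt_eqF.
(* Squares are compared: [S ^+ 2 <= A * B] bounds the left square by [4 * (A * p) * (B * q)], which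
   is at most [(A * p + B * q) ^+ 2]. *)
have cross : 2 * S * (a i * b i) <= A * p + B * q.
  have y0 : 0 <= A * p + B * q by apply: addr_ge0; exact: mulr_ge0.
  have : (2 * S * (a i * b i)) ^+ 2 <= (A * p + B * q) ^+ 2.
    rewrite exprMn pq exprMn.
    have := ler_wpM2r (mulr_ge0 q0 p0) SAB.
    have := sqr_ge0 (A * p - B * q).
    nra.
  move=> sq; rewrite leNgt; apply/negP => lt; nra.
rewrite sqrrD pq mulrDl !mulrDr.
lra.
Qed.

Section residual.
Context {R : realType} (d n : nat) (z : {ffun 'I_d -> 'I_n}).
Variables (alpha : R) (gamma : nat -> R).
Hypotheses (n_gt0 : (0 < n)%N) (gamma_gt0 : forall j, 0 < gamma j).
Implicit Types (u : {ffun 'I_d -> nat} -> R) (F H : seq {ffun 'I_d -> nat}).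

Definition cos_poly u F (x : point R d) : R := \sum_(l <- F) u l * phi l x.

(** Since [phi] is real, the algorithm acts separately on real and imaginary parts; this is its
    action on either of them. *)
Definition real_algorithm H (g : point R d -> R) (x : point R d) : R :=
  \sum_(k <- H)
    (n%:R^-1 * \sum_(1 <= i < n.+1) g (node z i) * phi k (node z i)) * phi k x.

Lemma sum_subseq_cond (I : eqType) (s t : seq I) (a : I -> R) :
  uniq s -> uniq t -> {subset s <= t} ->
  \sum_(i <- s) a i = \sum_(i <- t) (if i \in s then a i else 0).
Proof.
move=> us ut st; rewrite -big_mkcond -big_filter; apply: perm_big.
apply: uniq_perm => //; first exact: filter_uniq.
by move=> i; rewrite mem_filter; case: (boolP (i \in s)) => // /st ->.
Qed.

Lemma sum_delta (I : eqType) (s : seq I) (a : I -> R) k : uniq s ->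
  \sum_(l <- s) a l * (k == l)%:R = if k \in s then a k else 0.
Proof.
move=> us; case: ifPn => ks.
  rewrite (bigD1_seq k)//= eqxx mulr1 big1 ?addr0// => l lk.
  by rewrite eq_sym (negbTE lk) mulr0.
rewrite big_seq big1// => l ls; case: eqP => [kl|]; last by rewrite mulr0.
by rewrite kl ls in ks.
Qed.

(** The error of the lattice rule in the [k]-th coefficient of [cos_poly u F]. *)
Definition aliasing u F k : R := \sum_(l <- F) u l * quad_err z k l.

Definition residual_coef u F H k : R :=
  (if (k \in F) && (k \notin H) then u k else 0) -
  (if k \in H then aliasing u F k else 0).

(** By [quad_split] the computed coefficient is the true one plus the aliasing term. The true ones
    cancel on [H], leaving truncation outside [H] and aliasing inside. *)
Lemma residualE u F H x : uniq F -> uniq H ->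
  cos_poly u F x - real_algorithm H (cos_poly u F) x =
  \sum_(k <- undup (F ++ H)) residual_coef u F H k * phi k x.
Proof.
move=> uF uH.
have -> : real_algorithm H (cos_poly u F) x =
    \sum_(k <- H) ((if k \in F then u k else 0) + aliasing u F k) * phi k x.
  apply: eq_bigr => k _; congr (_ * _).
  transitivity (\sum_(l <- F) u l * quad z k l).
    under eq_bigr do rewrite mulr_suml.
    rewrite exchange_big mulr_sumr; apply: eq_bigr => l _ /=.
    rewrite /quad mulrCA; congr (_ * _); rewrite mulr_sumr.
    by apply: eq_bigr => i _; ring.
  under eq_bigr do rewrite quad_split// mulrDr.
  by rewrite big_split/= sum_delta.
have sF : {subset F <= undup (F ++ H)}.
  by move=> k kF; rewrite mem_undup mem_cat kF.
have sH : {subset H <= undup (F ++ H)}.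
  by move=> k kH; rewrite mem_undup mem_cat kH orbT.
rewrite /cos_poly (sum_subseq_cond _ uF (undup_uniq _) sF).
rewrite (sum_subseq_cond _ uH (undup_uniq _) sH) -sumrB.
apply: eq_bigr => k _; rewrite /residual_coef.
by case: (k \in F); case: (k \in H) => /=; ring.
Qed.

(** Truncation and aliasing have disjoint supports, so squaring produces no mixed terms. *)
Lemma sum_residual_coef u F H : uniq F -> uniq H ->
  \sum_(k <- undup (F ++ H)) residual_coef u F H k ^+ 2 =
  \sum_(l <- F | l \notin H) u l ^+ 2 + \sum_(k <- H) aliasing u F k ^+ 2.
Proof.
move=> uF uH.
have sF : {subset F <= undup (F ++ H)}.
  by move=> k kF; rewrite mem_undup mem_cat kF.
have sH : {subset H <= undup (F ++ H)}.
  by move=> k kH; rewrite mem_undup mem_cat kH orbT.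
rewrite [X in _ = X + _]big_mkcond (sum_subseq_cond _ uF (undup_uniq _) sF).
rewrite (sum_subseq_cond _ uH (undup_uniq _) sH) -big_split.
apply: eq_bigr => k _; rewrite /residual_coef.
by case: (k \in F); case: (k \in H) => /=; ring.
Qed.

Lemma aliasing_sqr u F k : aliasing u F k ^+ 2 <=
  (\sum_(l <- F) u l ^+ 2 * r alpha gamma (toZ l)) *
  (\sum_(l <- F) quad_err z k l ^+ 2 / r alpha gamma (toZ l)).
Proof.
by apply: weighted_cauchy_schwarz => l; exact: r_gt0.
Qed.

Lemma integral_residual u F H : uniq F -> uniq H ->
  (\int[lebesgue d]_(x in @cube R d)
     ((cos_poly u F x - real_algorithm H (cos_poly u F) x) ^+ 2)%:E)%E =
  (\sum_(l <- F | l \notin H) u l ^+ 2 + \sum_(k <- H) aliasing u F k ^+ 2)%:E.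
Proof.
move=> uF uH; under eq_integral do rewrite residualE//.
by rewrite integral_sum_phi ?undup_uniq// sum_residual_coef.
Qed.

Lemma measurable_residual u F H D : uniq F -> uniq H ->
  measurable_fun D (fun x => cos_poly u F x - real_algorithm H (cos_poly u F) x).
Proof.
move=> uF uH; rewrite (_ : (fun x => _) = (fun x =>
  \sum_(k <- undup (F ++ H)) residual_coef u F H k * phi k x)); last first.
  by apply/funext => x; exact: residualE.
apply: measurable_sum => k; apply: measurable_funM; first exact: measurable_cst.
exact: measurable_phi.
Qed.

(** Here [u] and [v] stand for the real and imaginary parts of the coefficients, which satisfy the
    norm bound only jointly. *)
Lemma integral_residual2 u v F H (M : R) : 0 < M -> uniq F -> uniq H ->
  (forall k, k \notin H -> M < r alpha gamma (toZ k)) ->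
  \sum_(l <- F) (u l ^+ 2 + v l ^+ 2) * r alpha gamma (toZ l) <= 1 ->
  (\int[lebesgue d]_(x in @cube R d)
     ((cos_poly u F x - real_algorithm H (cos_poly u F) x) ^+ 2 +
      (cos_poly v F x - real_algorithm H (cos_poly v F) x) ^+ 2)%:E <=
  (M^-1 + \sum_(k <- H) \sum_(l <- F) quad_err z k l ^+ 2 / r alpha gamma (toZ l))%:E)%E.
Proof.
move=> M0 uF uH HM uv1.
under eq_integral do rewrite EFinD.
rewrite ge0_integralD//; last 5 first.
- exact: measurable_cube.
- by move=> x _; rewrite lee_fin sqr_ge0.
- by apply/measurable_EFinP; apply: measurable_funX; exact: measurable_residual.
- by move=> x _; rewrite lee_fin sqr_ge0.
- by apply/measurable_EFinP; apply: measurable_funX; exact: measurable_residual.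
rewrite !integral_residual// -EFinD lee_fin addrACA -!big_split/=.
have uv0 l : 0 <= u l ^+ 2 + v l ^+ 2 by rewrite addr_ge0 ?sqr_ge0.
have r0 l : 0 < r alpha gamma (toZ l) :> R := r_gt0 alpha gamma_gt0 (toZ l).
apply: lerD.
  (* Truncation: outside [H] the weight exceeds [M], so the norm bound divided by [M] dominates. *)
  rewrite -[leRHS]mulr1 ler_pdivlMl// mulr_sumr.
  apply: le_trans uv1; rewrite big_mkcond; apply: ler_sum => l _.
  case: ifPn => [lH|_]; last by rewrite mulr_ge0// ltW.
  by rewrite mulrC ler_wpM2l// ltW// HM.
apply: ler_sum => k _.
(* Both Cauchy-Schwarz estimates share the factor in [quad_err], and their other factors add up to
   at most 1. *)
apply: le_trans (lerD (aliasing_sqr u F k) (aliasing_sqr v F k)) _.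
rewrite -mulrDl -big_split/= ler_piMl//.
  by apply: sumr_ge0 => l _; rewrite divr_ge0 ?sqr_ge0// ltW.
by under eq_bigr do rewrite -mulrDl.
Qed.
End residual.

(** * Passage to the limit *)

Section exhaustion.
Context {I : countType}.

(** A sequence cofinal among the finite subsets: it turns unconditional sums into limits of
    sequences, to which Fatou's lemma applies. *)
Definition first_items (m : nat) : {fset I} :=
  [fset i in pmap choice.unpickle (iota 0 m)]%fset.

Lemma first_items_sup (F : {fset I}) :
  exists N, forall m, (N <= m)%N -> (F `<=` first_items m)%fset.
Proof.
(* One more than the largest code in [F], because [iota 0 m] stops before [m]. *)
exists (\max_(i : F) choice.pickle (val i)).+1 => m Nm.
apply/fsubsetP => i iF; rewrite !inE /= mem_pmap.
apply/mapP; exists (choice.pickle i); last by rewrite choice.pickleK.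
rewrite mem_iota add0n; apply: leq_trans Nm; rewrite ltnS.
exact: (@leq_bigmax _ (fun j : F => choice.pickle (val j)) [` iF]%fset).
Qed.
End exhaustion.

(* [p] stands for either of [complex.Re] and [complex.Im]. *)
Section real_part.
Context {R : realType} (p : R[i] -> R).
Hypothesis (pD : {morph p : a b / a + b}).
Hypothesis (pM : forall w (x : R), p (w * x%:C) = p w * x).
Hypothesis (p_le : forall w, `|p w| <= Normc.normc w).

Lemma part0 : p 0 = 0.
Proof. by rewrite -(mulr0 0) (pM 0 0) mulr0. Qed.

Lemma partB : {morph p : a b / a - b}.
Proof.
by move=> a b; rewrite pD -mulrN1 -(rmorphN1 (real_complex R)) pM mulrN1.
Qed.

Lemma part_sum (I : Type) (s : seq I) (a : I -> R[i]) :
  p (\sum_(i <- s) a i) = \sum_(i <- s) p (a i).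
Proof. exact: (big_morph p pD part0). Qed.

Lemma has_sum_part (I : countType) (a : I -> R[i]) (w : R[i]) : has_sum a w ->
  \sum_(i <- first_items m) p (a i) @[m --> \oo] --> p w.
Proof.
move=> aw; apply/cvgrPdist_lt => e e0.
have [F0 F0e] := aw e e0; have [N hN] := first_items_sup F0.
near=> m.
have Nm : (N <= m)%N by near: m; exact: nbhs_infty_ge.
have := F0e _ (hN m Nm).
by rewrite -part_sum distrC -partB; apply: le_lt_trans (p_le _).
Unshelve. all: end_near. Qed.

Lemma part_realM (x : R) w : p (x%:C * w) = x * p w.
Proof. by rewrite mulrC pM mulrC. Qed.

Lemma part_algorithm d n (alpha : R) (gamma : nat -> R) M (z : {ffun 'I_d -> 'I_n})
    (f : point R d -> R[i]) x :
  finite_set (@hyperbolic_cross R d alpha gamma M) ->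
  p (algorithm alpha gamma M z f x) =
  real_algorithm z (fset_set (@hyperbolic_cross R d alpha gamma M)) (p \o f) x.
Proof.
move=> fH; rewrite /algorithm fsbig_finite//= part_sum /real_algorithm.
apply: eq_bigr => k _; rewrite pM; congr (_ * _).
rewrite -(rmorph_nat (real_complex R)) -fmorphV part_realM part_sum.
by congr (_ * _); apply: eq_bigr => i _; rewrite pM.
Qed.

Lemma cvg_cos_poly d (alpha : R) (gamma : nat -> R) (f : point R d -> R[i]) x :
  cosine_space alpha gamma f -> cube x ->
  cos_poly (p \o cos_coef f) (first_items m) x @[m --> \oo] --> p (f x).
Proof.
move=> [_ _ hf] /hf /has_sum_part; apply: cvg_trans.
by apply: near_eq_cvg; near=> m; apply: eq_bigr => k _; rewrite pM.
Unshelve. all: end_near. Qed.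

(** The algorithm samples its argument at finitely many nodes, all in the cube, where the cosine
    series converges pointwise. *)
Lemma cvg_residual d n (z : {ffun 'I_d -> 'I_n}) (alpha : R) (gamma : nat -> R)
    (f : point R d -> R[i]) (H : seq {ffun 'I_d -> nat}) x :
  cosine_space alpha gamma f -> cube x ->
  let S m := cos_poly (p \o cos_coef f) (first_items m) in
  S m x - real_algorithm z H (S m) x @[m --> \oo] -->
  p (f x) - real_algorithm z H (p \o f) x.
Proof.
move=> hf cx S; apply: cvgB; first exact: cvg_cos_poly hf cx.
apply: cvg_big => [|k _]; first exact: add_continuous.
apply: cvgMl; apply: cvgMr.
apply: cvg_big => [|i _]; first exact: add_continuous.
by apply: cvgMl; apply: cvg_cos_poly hf _; exact: node_cube.
Qed.
End real_part.

Section complex_parts.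
Context {R : realType}.
Implicit Types (a b w : R[i]).

Lemma ReD : {morph @complex.Re R : a b / a + b}.
Proof. by case=> a1 a2 [b1 b2]. Qed.

Lemma ImD : {morph @complex.Im R : a b / a + b}.
Proof. by case=> a1 a2 [b1 b2]. Qed.

Lemma ReM_real w (x : R) : complex.Re (w * x%:C) = complex.Re w * x.
Proof. by case: w => a b /=; rewrite mulr0 subr0. Qed.

Lemma ImM_real w (x : R) : complex.Im (w * x%:C) = complex.Im w * x.
Proof. by case: w => a b /=; rewrite mulr0 add0r. Qed.

Lemma normc_sqrE w : Normc.normc w ^+ 2 = complex.Re w ^+ 2 + complex.Im w ^+ 2.
Proof. by case: w => a b /=; rewrite sqr_sqrtr// addr_ge0 ?sqr_ge0. Qed.

Lemma Re_le_normc w : `|complex.Re w| <= Normc.normc w.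
Proof.
by case: w => a b /=; rewrite -sqrtr_sqr ler_wsqrtr// lerDl sqr_ge0.
Qed.

Lemma Im_le_normc w : `|complex.Im w| <= Normc.normc w.
Proof.
by case: w => a b /=; rewrite -sqrtr_sqr ler_wsqrtr// lerDr sqr_ge0.
Qed.
End complex_parts.

Lemma sqr_poweR_half (R : realType) (x : \bar R) : (0 <= x)%E ->
  ((x `^ 2^-1) ^+ 2 = x)%E.
Proof. by move=> x0; rewrite poweR12_sqrt// sqr_sqrte. Qed.

Lemma limn_einf_le (R : realType) (u : (\bar R)^nat) (b : \bar R) :
  (forall m, (u m <= b)%E) -> (limn_einf u <= b)%E.
Proof.
move=> ub; rewrite limn_einf_lim; apply: lime_le; first exact: is_cvg_einfs.
near=> m; apply: le_trans (ub m); apply: ereal_inf_lbound.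
by exists m => /=.
Unshelve. all: end_near. Qed.

(** * The worst-case error over the unit ball *)

Section worst_case.
Context {R : realType} (d n : nat) (z : {ffun 'I_d -> 'I_n}).
Variables (alpha : R) (gamma : nat -> R).
Hypotheses (n_gt0 : (0 < n)%N) (gamma_gt0 : forall j, 0 < gamma j).
Implicit Type f : point R d -> R[i].

Let r_ge0 h : 0 <= @r R d alpha gamma h.
Proof. exact/ltW/r_gt0. Qed.

Lemma cos_norm_le1 f (F : {fset {ffun 'I_d -> nat}}) :
  (Defs.cos_norm alpha gamma f <= 1)%E ->
  \sum_(l <- F) (complex.Re (cos_coef f l) ^+ 2 + complex.Im (cos_coef f l) ^+ 2) *
    r alpha gamma (toZ l) <= 1.
Proof.
rewrite /Defs.cos_norm; set s := esum _ _ => s1.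
have s0 : (0 <= s)%E.
  by apply: esum_ge0 => k _; rewrite lee_fin mulr_ge0// sqr_ge0.
have s_le1 : (s <= 1)%E.
  rewrite -(sqr_poweR_half s0) (_ : 1%E = (1 ^+ 2)%E :> \bar R); last first.
    by rewrite !expeS expe0 !mule1.
  by rewrite lee_sqr// poweR_ge0.
rewrite -lee_fin; apply: le_trans s_le1; rewrite /s -sumEFin.
apply: le_trans (sum_le_esum _ _ (fset_uniq F)).
rewrite big_mkcond [leRHS]big_mkcond le_eqVlt; apply/orP; left; apply/eqP.
by apply: eq_bigr => k _; rewrite in_setT normc_sqrE.
Qed.

Lemma L2_error_bound f (M : R) (H := fset_set (@hyperbolic_cross R d alpha gamma M)) :
  0 < M -> finite_set (@hyperbolic_cross R d alpha gamma M) ->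
  cosine_space alpha gamma f -> (Defs.cos_norm alpha gamma f <= 1)%E ->
  (\int[lebesgue d]_(x in @cube R d)
     (Normc.normc (f x - algorithm alpha gamma M z f x) ^+ 2)%:E <=
   (M^-1)%:E +
   \esum_(k in hyperbolic_cross alpha gamma M)
     \esum_(h in dual_lattice z `\ 0%R)
       (\sum_(s : {ffun 'I_d -> bool})
         2 ^+ nnz (toZ k) /
         (2 ^+ d * r alpha gamma (flip s h + toZ k)))%R%:E)%E.
Proof.
move=> M0 fH fc f1.
pose res (p : R[i] -> R) m (x : point R d) :=
  cos_poly (p \o cos_coef f) (first_items m) x -
  real_algorithm z H (cos_poly (p \o cos_coef f) (first_items m)) x.
pose g m (x : point R d) :=
  (res (@complex.Re R) m x ^+ 2 + res (@complex.Im R) m x ^+ 2)%:E.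
have HM k : k \notin H -> M < r alpha gamma (toZ k).
  by rewrite in_fset_set// notin_setE /hyperbolic_cross /= => /negP; rewrite -ltNge.
(* The bound is uniform in [m]: the finite sums over [l] are absorbed by the sum over the dual
   lattice. *)
have Bm m : (\int[lebesgue d]_(x in @cube R d) g m x <= (M^-1)%:E +
   \esum_(k in hyperbolic_cross alpha gamma M)
     \esum_(h in dual_lattice z `\ 0%R)
       (\sum_(s : {ffun 'I_d -> bool})
         2 ^+ nnz (toZ k) /
         (2 ^+ d * r alpha gamma (flip s h + toZ k)))%R%:E)%E.
  apply: le_trans (integral_residual2 z n_gt0 gamma_gt0 M0 (fset_uniq _) (fset_uniq H) HM
    (cos_norm_le1 (first_items m) f1)) _.
  rewrite EFinD leeD2l// -sumEFin esum_fset//; last first.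
    move=> k _; apply: esum_ge0 => h _; rewrite lee_fin; apply: sumr_ge0 => s _.
    by rewrite divr_ge0 ?exprn_ge0// mulr_ge0 ?exprn_ge0.
  rewrite fsbig_finite//; apply: lee_sum => k _.
  by apply: sum_quad_err => //; exact: fset_uniq.
have mg m : measurable_fun (@cube R d) (g m).
  apply/measurable_EFinP; apply: measurable_funD; apply: measurable_funX;
    by apply: measurable_residual => //; exact: fset_uniq.
have g0 m x : @cube R d x -> (0 <= g m x)%E.
  by move=> _; rewrite lee_fin addr_ge0 ?sqr_ge0.
apply: le_trans (limn_einf_le Bm).
apply: le_trans (fatou (lebesgue d) (@measurable_cube R d) mg g0).
rewrite le_eqVlt; apply/orP; left; apply/eqP.
(* On the cube the limit inferior in Fatou's lemma is an actual limit, namely the squared error at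
   [x]. *)
apply: eq_integral => x /set_mem cx.
suff : g ^~ x @ \oo --> (Normc.normc (f x - algorithm alpha gamma M z f x) ^+ 2)%:E.
  by move=> /cvg_limn_einf_sup[-> _].
apply: cvg_EFin; first by near=> m.
rewrite normc_sqrE (partB (@ReD R) (@ReM_real R)) (partB (@ImD R) (@ImM_real R)).
rewrite (part_algorithm (@ReD R) (@ReM_real R))// (part_algorithm (@ImD R) (@ImM_real R))//.
rewrite !expr2; apply: cvgD; apply: cvgM; apply: cvg_residual fc cx;
  by [exact: ReD|exact: ImD|exact: ReM_real|exact: ImM_real
     |exact: Re_le_normc|exact: Im_le_normc].
Unshelve. all: end_near. Qed.

(** The zero function shows that the supremum is over a non-empty set. It yields the nonnegativity
    of [wor_error] and of the bound that the passage between squares and roots requires. *)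
Lemma cosine_space0 : cosine_space alpha gamma (cst 0%R : point R d -> R[i]) /\
  (Defs.cos_norm alpha gamma (cst 0%R : point R d -> R[i]) <= 1)%E.
Proof.
have c0 k : cos_coef (cst 0%R : point R d -> R[i]) k = 0 :> R[i].
  rewrite /cos_coef /cintegral.
  have E x : (0 : R[i]) * (@phi R d k x)%:C = 0 by rewrite mul0r.
  under eq_Rintegral do rewrite E /=.
  under [X in _ +i* X]eq_Rintegral do rewrite E /=.
  by rewrite /Rintegral !integral0.
have n0 : Defs.cos_norm alpha gamma (cst 0%R : point R d -> R[i]) = 0.
  rewrite /Defs.cos_norm esum1 ?poweR0r// ?invr_eq0// => k _.
  by rewrite c0 Normc.normc0 expr0n mul0r.
split; last by rewrite n0.
split.
- split; try exact: measurable_cst.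
  rewrite /L2norm; under eq_integral do rewrite Normc.normc0 expr0n.
  by rewrite integral0 poweR0r// ?ltry// invr_eq0.
- by rewrite n0 ltry.
- move=> x _ e e0; exists fset0 => F _.
  by rewrite big1 ?subrr ?Normc.normc0// => k _; rewrite c0 mul0r.
Qed.
End worst_case.

Theorem theorem6 (R : realType) (d n : nat) (alpha : R) (gamma : nat -> R)
    (M : R) (z : {ffun 'I_d -> 'I_n})
    (d_gt0 : (0 < d)%N) (n_gt0 : (0 < n)%N)
    (alpha_gt : 2^-1 < alpha)
    (gamma0_le1 : gamma 0%N <= 1)
    (gamma_noninc : forall j, gamma j.+1 <= gamma j)
    (gamma_gt0 : forall j, 0 < gamma j)
    (M_ge1 : 1 <= M) :
  ((wor_error alpha gamma M z) ^+ 2 <=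
   (M^-1)%:E +
   \esum_(k in hyperbolic_cross alpha gamma M)
     \esum_(h in dual_lattice z `\ 0%R)
       (\sum_(s : {ffun 'I_d -> bool})
         2 ^+ nnz (toZ k) /
         (2 ^+ d * r alpha gamma (flip s h + toZ k)))%R%:E)%E.
Proof.
have M0 : 0 < M by exact: lt_le_trans M_ge1.
have fH : finite_set (@hyperbolic_cross R d alpha gamma M).
  exact: finite_hyperbolic_cross.
set B := (_ + _)%E.
have I0 (f : point R d -> R[i]) :
    (0 <= \int[lebesgue d]_(x in @cube R d) (Normc.normc (f x) ^+ 2)%:E)%E.
  by apply: integral_ge0 => x _; rewrite lee_fin sqr_ge0.
have [z0 z1] := @cosine_space0 R d alpha gamma.
have B0 : (0 <= B)%E.
  exact: le_trans (I0 _) (L2_error_bound z n_gt0 gamma_gt0 M0 fH z0 z1).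
(* Writing the bound as the square of its root reduces the claim to an estimate of the norm for each
   [f]. *)
rewrite -(sqr_poweR_half B0) lee_sqr ?poweR_ge0//.
  apply: ge_ereal_sup => _ [f [fc f1] <-].
  apply: gt0_ler_poweR; rewrite ?in_itv/= ?leey ?andbT//.
  exact: L2_error_bound.
pose f0 : point R d -> R[i] := cst 0.
apply: (@le_trans _ _ (L2norm (fun x => f0 x - algorithm alpha gamma M z f0 x))).
  exact: poweR_ge0.
by apply: ereal_sup_ubound; exists f0.
Qed.
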